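(* Let $n\ge1$ and let $(\xi_i,\mathcal{F}_i)_{i=0,\dots,n}$ be a sequence of real-valued martingale differences on $(\Omega,\mathcal{F},\mathbf{P})$ with $\xi_0=0$, $\{\emptyset,\Omega\}=\mathcal{F}_0\subseteq\cdots\subseteq\mathcal{F}_n\subseteq\mathcal{F}$ and $\mathbf{E}[\xi_i\mid\mathcal{F}_{i-1}]=0$. Let $S_k=\sum_{i=1}^k\xi_i$ and $\langle S\rangle_k=\sum_{i=1}^k\mathbf{E}[\xi_i^2\mid\mathcal{F}_{i-1}]$. Let $p\ge2$ and $\delta>0$, and assume $\mathbf{E}[|\xi_i|^{p+\delta}]<\infty$ for all $i\in[1,n]$. Then for all $x,v>0$, $$\mathbf{P}\big(S_k\ge x\text{ and }\langle S\rangle_k\le v^2\text{ for some }k\in[1,n]\big)\le\exp\Bigg\{-\frac{x^2}{2\big(v^2+\frac13x^{(2p+\delta)/(p+\delta)}\big)}\Bigg\}+\frac{1}{x^p}\sum_{i=1}^n\mathbf{E}\Big[|\xi_i|^{p+\delta}\mathbf{1}_{\{\xi_i>x^{p/(p+\delta)}\}}\Big].$$ *)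

(* Defs.v *)
From HB Require Import structures.
From mathcomp Require Import all_boot all_order all_algebra.
From mathcomp Require Import all_classical all_reals all_analysis.
Set Implicit Arguments. Unset Strict Implicit. Unset Printing Implicit Defensive.
Import Order.TTheory GRing.Theory Num.Theory.
Local Open Scope classical_set_scope.
Local Open Scope ring_scope.

Section Defs.
Context {d : measure_display} {T : measurableType d} {R : realType}.

Definition sub_sigma (G : set (set T)) : Prop :=
  sigma_algebra setT G /\ G `<=` measurable.

Definition measurable_wrt (G : set (set T)) (f : T -> R) : Prop :=
  forall B : set R, measurable B -> G (f @^-1` B).

Definition is_cond_exp (P : probability T R) (G : set (set T)) (f g : T -> R) : Prop :=
  [/\ measurable_wrt G g, P.-integrable setT (EFin \o g) &
      forall A, G A -> (\int[P]_(w in A) (g w)%:E = \int[P]_(w in A) (f w)%:E)%E].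

Definition is_filtration (n : nat) (F : nat -> set (set T)) : Prop :=
  [/\ (forall i, (i <= n)%N -> sub_sigma (F i)),
      F 0%N = [set A | A = set0 \/ A = setT] &
      (forall i, (i < n)%N -> F i `<=` F i.+1)].

Definition is_mds (P : probability T R) (n : nat) (F : nat -> set (set T))
    (xi : nat -> T -> R) : Prop :=
  [/\ is_filtration n F, xi 0%N = (fun=> 0) &
      forall i, (1 <= i <= n)%N ->
        [/\ measurable_wrt (F i) (xi i), P.-integrable setT (EFin \o xi i) &
            is_cond_exp P (F i.-1) (xi i) (fun=> 0)]].

End Defs.

(* Main.v *)
Require Import Defs.
From HB Require Import structures.
From mathcomp Require Import all_boot all_order all_algebra.
From mathcomp Require Import all_classical all_reals all_analysis.
From mathcomp Require Import measurable_realfun ring lra.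
Import Order.TTheory GRing.Theory Num.Theory.
Import numFieldNormedType.Exports.
Local Open Scope classical_set_scope.
Local Open Scope ring_scope.

(* Put [y = x^(p/(p+delta))] and truncate: outside the events [xi_i > y], whose
   total probability Markov's inequality bounds by the moment term because
   [y^(p+delta) = x^p], the martingale [S] coincides with the sum [S'] of the
   [xi_i 1_{xi_i <= y}]. These summands are at most [y], have nonpositive
   conditional means and conditional second moments at most those of [xi_i], so
   Bernstein's bound [e^u <= 1 + u + u^2 / (2 (1 - b/3))] for [u <= b < 3] makes
   [exp (l S'_k - c <S>_k)] a supermartingale, with
   [c = l^2 / (2 (1 - l y / 3))]. Stopping it when it first reaches the level
   [exp (l x - c v^2)] gives the probability bound [exp (- l x + c v^2)], which
   for [l = x / (v^2 + x y / 3)] is the exponential term, as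
   [x y = x^((2p+delta)/(p+delta))]. Only versions of conditional expectations
   are available, so the supermartingale property is expressed by integrating
   against bounded nonnegative weights measurable with respect to the past. *)

(** * Bernstein's bound for the exponential function *)

Lemma ge0_derive_sign {R : realType} (f df : R -> R) :
  (forall u : R, is_derive u (1 : R) f (df u)) -> f 0 = 0 ->
  (forall u, 0 <= u -> 0 <= df u) -> (forall u, u <= 0 -> df u <= 0) ->
  forall u, 0 <= f u.
Proof.
move=> fd f0 dfp dfn u.
have cf : continuous f.
  by move=> z; apply: differentiable_continuous; apply/derivable1_diffP; case: (fd z).
have dE z : derive1 f z = df z by rewrite derive1E; apply: derive_val.
have [u0|u0] := leP 0 u.
- rewrite -f0; apply: (@ger0_derive1_ndecry _ f 0) => //.
  + by move=> z; rewrite in_itv/= andbT dE => /ltW /dfp.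
  + exact: continuous_subspaceT.
- rewrite -f0; apply: (@ler0_derive1_nincrNy _ f 0) => //; last exact: ltW.
  + by move=> z; rewrite in_itv/= dE => /ltW /dfn.
  + exact: continuous_subspaceT.
Qed.

(** The polynomials form a Pade approximant of [expR] at 0. The derivative [k] of the difference of
    the two sides vanishes at 0 and is nondecreasing because [(1 - z) * expR z <= 1], so the
    difference is least at 0, where it vanishes. *)
Lemma expR_pade {R : realType} (u : R) : (6 - 2 * u) * expR u <= 6 + 4 * u + u ^+ 2.
Proof.
have one_sub_expR (z : R) : (1 - z) * expR z <= 1.
  rewrite -ler_pdivlMr ?expR_gt0// mul1r -expRN; exact: expR_ge1Dx.
pose k (z : R) := 4 + 2 * z - (4 - 2 * z) * expR z.
have kd (z : R) : is_derive z (1 : R) k (2 - (2 - 2 * z) * expR z).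
  by rewrite /k; apply: is_derive_eq; rewrite /GRing.scale/=; ring.
have k0 : k 0 = 0 by rewrite /k expR0; ring.
have kz (a b : R) : a <= b -> k a <= k b.
  move=> ab; apply: (@ger0_derive1_ndecr _ k a b) => //.
  - move=> z _; rewrite derive1E derive_val.
    have := one_sub_expR z; lra.
  - apply: continuous_subspaceT => z.
    by apply: differentiable_continuous; apply/derivable1_diffP; have [] := kd z.
have := @ge0_derive_sign R (fun z => 6 + 4 * z + z ^+ 2 - (6 - 2 * z) * expR z) k.
rewrite -subr_ge0; apply.
- move=> z; rewrite /k; apply: is_derive_eq; rewrite /GRing.scale/=; ring.
- by rewrite expR0; ring.
- by move=> z /kz; rewrite k0.
- by move=> z /kz; rewrite k0.
Qed.

(** For [b = u] the right side is exactly the Pade quotient, and its quadratic coefficient only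
    grows when [u] is raised to [b]. As [u] may be arbitrarily negative, truncating the increments
    from above is enough. *)
Lemma expR_le_bernstein {R : realType} (b u : R) : b < 3 -> u <= b ->
  expR u <= 1 + u + (2 * (1 - b / 3))^-1 * u ^+ 2.
Proof.
move=> b3 ub; have u3 : 0 < 6 - 2 * u by lra.
have : expR u <= 1 + u + (2 * (1 - u / 3))^-1 * u ^+ 2.
  rewrite -(ler_pM2l u3); apply: le_trans (expR_pade u) _.
  rewrite le_eqVlt; apply/orP; left; apply/eqP; field.
  by apply/eqP; lra.
move=> /le_trans; apply; rewrite lerD2l ler_wpM2r ?sqr_ge0//.
rewrite lef_pV2 ?posrE; lra.
Qed.

(** * Weighted integrals against versions of conditional expectations *)

Section ConditionalExpectation.
Set Implicit Arguments.
Unset Strict Implicit.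
Context {d : measure_display} {T : measurableType d} {R : realType}.
Variable P : probability T R.
Implicit Types (W h f : T -> R).

Lemma integrable_mul_bounded W h (C : R) : measurable_fun setT W ->
  (forall w, `|W w| <= C) -> P.-integrable setT (EFin \o h) ->
  P.-integrable setT (EFin \o (fun w => W w * h w)).
Proof.
move=> mW WC ih; have := @integrableMr _ _ _ _ _ measurableT W (EFin \o h) mW _ ih; apply.
exists C; split; first exact: num_real.
by move=> M CM w _; apply: le_trans (WC w) _; exact: ltW.
Qed.

Lemma integrable_bounded W (C : R) : measurable_fun setT W ->
  (forall w, `|W w| <= C) -> P.-integrable setT (EFin \o W).
Proof.
move=> mW WC; apply: measurable_bounded_integrable => //.
  by rewrite (le_lt_trans (probability_le1 _ _)) ?ltry.
exists C; split; first exact: num_real.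
by move=> M CM w _; apply: le_trans (WC w) _; exact: ltW.
Qed.

Variable G : set (set T).
Hypothesis sG : sub_sigma G.

(** A sigma-algebra generates itself; this transfers to [measurable_wrt] the closure of measurable
    functions under products, maxima and composition. *)
Lemma measurable_wrtP f :
  measurable_wrt G f <->
  measurable_fun [set: g_sigma_algebraType G] (f : g_sigma_algebraType G -> R).
Proof.
have [sa _] := sG; split.
- move=> mf _ B mB; rewrite setTI; apply: sub_sigma_algebra; exact: mf.
- move=> mf B mB; rewrite -(measurable_g_measurableTypeE sa).
  by rewrite -[X in measurable X]setTI; exact: mf.
Qed.

Lemma measurable_wrt_fun f : measurable_wrt G f -> measurable_fun setT f.
Proof. by move=> mf _ B mB; rewrite setTI; apply: (proj2 sG); exact: mf. Qed.

(* The multiples [m * W] are within 1 of [truncn (m * W)], a finite sum of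
   indicators of sets of [G]; dividing by [m] makes the error negligible. *)
Lemma Rintegral_mul_eq0 W h (C : R) :
  measurable_wrt G W -> (forall w, 0 <= W w <= C) ->
  P.-integrable setT (EFin \o h) ->
  (forall A, G A -> \int[P]_(w in A) h w = 0) ->
  \int[P]_w (W w * h w) = 0.
Proof.
move=> mW WC ih hG; pose N := (Num.truncn C).+1.
have WN w : 0 <= W w <= N%:R.
  by have /andP[-> WCw] := WC w; rewrite (le_trans WCw)// ltW// truncnS_gt.
have mh : measurable_fun setT h by apply/measurable_EFinP; exact: measurable_int ih.
(* [truncn (m * W)] counts the [j] with [j.+1 <= m * W], hence is the sum of the indicators of these
   events; [j < m * N] suffices as [W <= N]. *)
pose A (m j : nat) := W @^-1` [set r | j.+1%:R <= m%:R * r].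
have GA m j : G (A m j).
  apply: mW; rewrite -[X in measurable X]setTI.
  by apply: (measurable_fun_ler _ _ measurableT) => //; exact: mulrl_measurable.
have mA m j : measurable (A m j) by apply: (proj2 sG); exact: GA.
have iA m j : P.-integrable setT (EFin \o (fun w => \1_(A m j) w * h w)).
  apply: (@integrable_mul_bounded _ _ 1) => // w.
  by rewrite indicE ger0_norm ?ler0n// lern1 leq_b1.
have sumA m k : P.-integrable setT (EFin \o (fun w => (\sum_(j < k) \1_(A m j) w) * h w))
    /\ \int[P]_w ((\sum_(j < k) \1_(A m j) w) * h w) = 0.
  elim: k => [|k [ik IHk]].
    under [in X in X /\ _]eq_fun do rewrite big_ord0 mul0r.
    under eq_Rintegral do rewrite big_ord0 mul0r.
    split; first exact: finite_measure_integrable_cst.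
    by rewrite Rintegral_cst// mul0r.
  under [in X in X /\ _]eq_fun do rewrite big_ord_recr/= mulrDl.
  under eq_Rintegral do rewrite big_ord_recr/= mulrDl.
  split; first exact: (integrableD measurableT ik (iA m k)).
  rewrite RintegralD// IHk add0r -[RHS](hG _ (GA m k)) [RHS]Rintegral_mkcond.
  apply: eq_Rintegral => w _; rewrite patchE indicE.
  by case: (w \in A m k); rewrite ?mul1r ?mul0r.
have sum_truncn m w : \sum_(j < m * N) \1_(A m j) w = (Num.truncn (m%:R * W w))%:R :> R.
  have /andP[W0 WNw] := WN w.
  have le_truncn : (Num.truncn (m%:R * W w) <= m * N)%N.
    by rewrite -(ler_nat R) natrM (le_trans _ (ler_wpM2l _ WNw)) ?truncn_le ?mulr_ge0.
  transitivity (\sum_(j < m * N | (j < Num.truncn (m%:R * W w))%N) (1 : R)).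
    rewrite [RHS]big_mkcond; apply: eq_bigr => j _.
    rewrite indicE truncn_gt_nat.
    by case: ifPn => [le_mW|/negP ?]; [rewrite mem_set|rewrite memNset].
  by rewrite -(big_ord_widen _ (fun=> 1) le_truncn) sumr_const card_ord.
have iW : P.-integrable setT (EFin \o (fun w => W w * h w)).
  apply: (@integrable_mul_bounded _ _ N%:R) => //; first exact: measurable_wrt_fun.
  by move=> w; have /andP[? ?] := WN w; rewrite ger0_norm.
have bound m : m%:R * `|\int[P]_w (W w * h w)| <= \int[P]_w `|h w|.
  have [iS S0] := sumA m (m * N)%N.
  have iWm := integrableZl measurableT m%:R iW.
  rewrite -[m%:R]ger0_norm// -normrM -RintegralZl// -[X in `|X|]subr0 -S0 -RintegralB//.
  apply: le_trans (le_normr_Rintegral _ _) _ => //.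
    exact: (integrableB measurableT iWm iS).
  apply: le_Rintegral => //.
  - exact: (integrable_abse (integrableB measurableT iWm iS)).
  - exact: (integrable_abse ih).
  move=> w _; rewrite sum_truncn mulrA -mulrBl normrM ler_piMl//.
  have /andP[W0 WNw] := WN w.
  have /truncn_itv/andP[t1 t2] : 0 <= m%:R * W w by rewrite mulr_ge0.
  by rewrite ger0_norm; rewrite ?subr_ge0// lerBlDl natr1 ltW.
(* A nonzero integral would violate [bound] as soon as [m] exceeds the ratio of the integral of
   [|h|] to its absolute value. *)
apply/eqP; rewrite -normr_eq0; apply/negPn/negP => n0.
have In0 : 0 < `|\int[P]_w (W w * h w)| by rewrite lt_neqAle eq_sym n0 normr_ge0.
have := bound (Num.truncn (\int[P]_w `|h w| / `|\int[P]_w (W w * h w)|)).+1.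
by apply/negP; rewrite -ltNge -ltr_pdivrMr// truncnS_gt.
Qed.

Lemma cond_exp_sub_Rintegral_eq0 f g : is_cond_exp P G f g ->
  P.-integrable setT (EFin \o f) ->
  forall A, G A -> \int[P]_(w in A) (f w - g w) = 0.
Proof.
move=> [_ ig fg] jf A GA; have mA : measurable A := proj2 sG _ GA.
have iA h : P.-integrable setT (EFin \o h) -> P.-integrable A (EFin \o h).
  exact: integrableS.
by rewrite RintegralB ?iA// /Rintegral fg// subrr.
Qed.

(** The defining identity on the whole space equates the integral of [f] with the finite integral of
    [g]. *)
Lemma cond_exp_ge0_integrable f g : is_cond_exp P G f g -> measurable_fun setT f ->
  (forall w, 0 <= f w) -> P.-integrable setT (EFin \o f).
Proof.
move=> [mg ig fg] mf f0; have GT : G setT.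
  have [[G0 GC _] _] := sG; rewrite -[setT]setD0; exact: GC.
apply/integrableP; split; first exact/measurable_EFinP.
rewrite (eq_integral (EFin \o f)); last first.
  by move=> w _; rewrite gee0_abs ?lee_fin.
rewrite /comp -fg//.
by have [] := integral_fune_fin_num measurableT ig; rewrite ltey_eq => ->.
Qed.

(** One step of the supermartingale: Bernstein's bound majorizes the truncated exponential by
    [1 + l * X + c * X ^+ 2]. Against a weight from the past, [X] integrates to 0 and [X ^+ 2] may
    be exchanged for [V], whose contribution the compensating factor absorbs. *)
Lemma Rintegral_exp_increment X V W (C l y : R) :
  measurable_fun setT X -> P.-integrable setT (EFin \o X) ->
  is_cond_exp P G X (fun=> 0) -> is_cond_exp P G (fun w => X w ^+ 2) V ->
  measurable_wrt G W -> (forall w, 0 <= W w <= C) ->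
  0 <= l -> 0 < y -> l * y < 3 ->
  \int[P]_w (W w * expR (l * (if X w <= y then X w else 0)
      - (2 * (1 - l * y / 3))^-1 * l ^+ 2 * Num.max (V w) 0))
    <= \int[P]_w W w.
Proof.
move=> mX iX X0 XV mW WC l0 y0 ly3; set c := _ * l ^+ 2.
have b0 : 0 < 1 - l * y / 3 by lra.
have c0 : 0 <= c by rewrite mulr_ge0 ?sqr_ge0// invr_ge0; lra.
have mV : measurable_wrt G V by case: XV.
(* [U] is measurable with respect to [G], so integrating against it annihilates
   both [X] and [X ^+ 2 - V]. *)
pose U w := W w * expR (- (c * Num.max (V w) 0)).
have mVp : measurable_wrt G (fun w => Num.max (V w) 0).
  apply/measurable_wrtP; apply: measurable_maxr => //; exact/measurable_wrtP.
have mU : measurable_wrt G U.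
  apply/measurable_wrtP; apply: measurable_funM; first exact/measurable_wrtP.
  apply: measurableT_comp => //; apply: measurableT_comp => //.
  by apply: measurable_funM => //; exact/measurable_wrtP.
have Vp0 w : 0 <= Num.max (V w) 0 by rewrite le_max lexx orbT.
have U0 w : 0 <= U w by have /andP[? _] := WC w; rewrite mulr_ge0// expR_ge0.
(* A version [V] may be negative somewhere; its positive part keeps the exponential factor at most
   1, so [U] inherits the bound [C]. *)
have UC w : 0 <= U w <= C.
  rewrite U0; have /andP[W0 WCw] := WC w; apply: le_trans WCw.
  by rewrite ler_piMr// -expR0 ler_expR oppr_le0 mulr_ge0.
have mUT := measurable_wrt_fun mU.
have nU w : `|U w| <= C by have /andP[? ?] := UC w; rewrite ger0_norm.
have iW : P.-integrable setT (EFin \o W).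
  apply: (@integrable_bounded _ C); first exact: measurable_wrt_fun.
  by move=> w; have /andP[? ?] := WC w; rewrite ger0_norm.
have mX2 : measurable_fun setT (fun w => X w ^+ 2) by exact: measurable_funX.
have iX2 : P.-integrable setT (EFin \o (fun w => X w ^+ 2)).
  by apply: (cond_exp_ge0_integrable XV) => // w; exact: sqr_ge0.
have iV : P.-integrable setT (EFin \o V) by case: XV.
have UX : \int[P]_w (U w * X w) = 0.
  apply: (@Rintegral_mul_eq0 _ _ C) => // A GA.
  rewrite -[RHS](cond_exp_sub_Rintegral_eq0 X0 iX GA).
  by apply: eq_Rintegral => w _; rewrite subr0.
have UXV : \int[P]_w (U w * (X w ^+ 2 - V w)) = 0.
  apply: (@Rintegral_mul_eq0 _ _ C) => //.
    exact: (integrableB measurableT iX2 iV).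
  exact: cond_exp_sub_Rintegral_eq0.
have iUX := integrableZl measurableT l (integrable_mul_bounded mUT nU iX).
have iUXV := integrableZl measurableT c
  (integrable_mul_bounded mUT nU (integrableB measurableT iX2 iV)).
have iS := integrableD measurableT (integrableD measurableT iW iUX) iUXV.
have trunc_le w : l * (if X w <= y then X w else 0) - c * Num.max (V w) 0 <= l * y.
  rewrite lerBlDr; apply: (@le_trans _ _ (l * y)); last by rewrite lerDl mulr_ge0.
  by rewrite ler_wpM2l//; case: ifPn => // _; exact: ltW.
have mXy : measurable_fun setT (fun w => if X w <= y then X w else 0).
  by apply: measurable_fun_ifT => //; exact: measurable_fun_ler.
apply: (@le_trans _ _ (\int[P]_w (W w + l * (U w * X w) + c * (U w * (X w ^+ 2 - V w))))).
  apply: le_Rintegral => //.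
  - apply: (@integrable_bounded _ (C * expR (l * y))).
      apply: measurable_funM; first exact: measurable_wrt_fun.
      apply: measurableT_comp => //; apply: measurable_funB.
        exact: measurable_funM.
      by apply: measurable_funM => //; exact: measurable_wrt_fun.
    move=> w; have /andP[W0 WCw] := WC w.
    by rewrite ger0_norm ?mulr_ge0 ?expR_ge0// ler_pM ?expR_ge0// ler_expR.
  move=> w _.
  have expX : expR (l * (if X w <= y then X w else 0)) <= 1 + l * X w + c * X w ^+ 2.
    have [Xy|/ltW yX] := leP (X w) y.
      by rewrite /c -mulrA -exprMn; apply: expR_le_bernstein => //; rewrite ler_wpM2l.
    (* Above the truncation level the left side is 1, and [X] is positive. *)
    rewrite mulr0 expR0 -addrA lerDl; apply: addr_ge0.
      by apply: mulr_ge0 => //; apply: le_trans yX; exact: ltW.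
    by apply: mulr_ge0 => //; exact: sqr_ge0.
  have UV : U w * (1 + c * V w) <= W w.
    have -> : W w = U w * expR (c * Num.max (V w) 0).
      by rewrite /U -mulrA -expRD addNr expR0 mulr1.
    rewrite ler_wpM2l//; apply: le_trans (expR_ge1Dx _).
    by rewrite lerD2l ler_wpM2l// le_max lexx.
  rewrite [leLHS](_ : _ = U w * expR (l * (if X w <= y then X w else 0))); last first.
    by rewrite /U -mulrA -expRD [in RHS]addrC.
  apply: le_trans (ler_wpM2l (U0 w) expX) _; lra.
rewrite (RintegralD measurableT (integrableD measurableT iW iUX) iUXV).
rewrite (RintegralD measurableT iW iUX) !RintegralZl//.
- by rewrite UX UXV !mulr0 !addr0.
- exact: integrable_mul_bounded mUT nU (integrableB measurableT iX2 iV).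
- exact: integrable_mul_bounded mUT nU iX.
Qed.

End ConditionalExpectation.

(** * Maximal inequality through a stopped exponential supermartingale *)

Section StoppedSum.
Set Implicit Arguments.
Unset Strict Implicit.
Context {d : measure_display} {T : measurableType d} {R : realType}.
Variable P : probability T R.
Variables (n : nat) (F : nat -> set (set T)) (D : nat -> T -> R) (a B : R).

(** Freezing the value once it reaches [a] takes the place of an explicit stopping time, so
    adaptedness and bounds follow by induction on [k]. *)
Fixpoint stopped_sum (k : nat) (w : T) : R :=
  if k is j.+1 then
    let s := stopped_sum j w in if a <= s then s else s + D k w
  else 0.

Lemma stopped_sum_ge (k : nat) (w : T) :
  (exists2 j, (j <= k)%N & a <= \sum_(1 <= i < j.+1) D i w) -> a <= stopped_sum k w.
Proof.
have [//|lt_ka] := leP a (stopped_sum k w).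
(* A stopped sum still below [a] at time [k] was never frozen, so up to [k] it equals the plain
   partial sums, all below [a]. *)
have sumE j : (j <= k)%N ->
    \sum_(1 <= i < j.+1) D i w = stopped_sum j w /\ stopped_sum j w < a.
  elim: k lt_ka j => [|k IHk] /=.
    by move=> ? j; rewrite leqn0 => /eqP ->; rewrite big_geq.
  case: ifPn => [le_a lt_a|]; first by rewrite ltNge le_a in lt_a.
  rewrite -ltNge => lt_ka lt_kD j; rewrite leq_eqVlt => /predU1P[->/=|].
    have [eqk _] := IHk lt_ka k (leqnn k).
    by rewrite ifN -?ltNge// big_nat_recr//= eqk.
  by rewrite ltnS; exact: IHk.
by case=> j /sumE[-> lt_ja]; rewrite leNgt lt_ja.
Qed.

Hypothesis filF : is_filtration n F.
Hypothesis mD : forall i, (1 <= i <= n)%N -> measurable_wrt (F i) (D i).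
Hypotheses (B0 : 0 <= B) (DB : forall i w, (1 <= i <= n)%N -> D i w <= B).
Hypothesis superD : forall i (C : R) W, (i < n)%N -> measurable_wrt (F i) W ->
  (forall w, 0 <= W w <= C) ->
  \int[P]_w (W w * expR (D i.+1 w)) <= \int[P]_w W w.

Lemma measurable_stopped_sum k : (k <= n)%N -> measurable_wrt (F k) (stopped_sum k).
Proof.
have [sF _ monF] := filF.
elim: k => [|k IHk] kn /=.
  by apply/(measurable_wrtP (sF _ kn)).
have mk : measurable_wrt (F k.+1) (stopped_sum k).
  by move=> A mA; apply: monF => //; apply: IHk => //; exact: ltnW.
apply/(measurable_wrtP (sF _ kn)); move/(measurable_wrtP (sF _ kn)) in mk.
apply: measurable_fun_ifT => //; first exact: measurable_fun_ler.
by apply: measurable_funD => //; apply/(measurable_wrtP (sF _ kn)); exact: mD.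
Qed.

Lemma stopped_sum_le k w : (k <= n)%N -> stopped_sum k w <= k%:R * B.
Proof.
elim: k => [|k IHk] kn /=; first by rewrite mul0r.
have {}IHk := IHk (ltnW kn); rewrite -natr1 mulrDl mul1r.
case: ifP => _; first by rewrite (le_trans IHk)// lerDl.
by rewrite lerD// DB.
Qed.

(** The part already frozen does not change in a step. On the rest, the exponential so far is a
    bounded weight from the past, to which [superD] applies. *)
Lemma Rintegral_exp_stopped_sum k : (k <= n)%N ->
  \int[P]_w expR (stopped_sum k w) <= 1.
Proof.
have [sF _ monF] := filF.
elim: k => [|k IHk] kn /=.
  under eq_Rintegral do rewrite expR0.
  rewrite Rintegral_cst// mul1r -lee_fin fineK; last exact: fin_num_measure.
  exact: probability_le1.
have kn' := ltnW kn; apply: le_trans (IHk kn').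
have sFk := sF _ kn'.
pose st b w : R := if (a <= stopped_sum k w) == b then expR (stopped_sum k w) else 0.
have mst b : measurable_wrt (F k) (st b).
  have mk := measurable_stopped_sum kn'; apply/(measurable_wrtP sFk).
  move/(measurable_wrtP sFk) in mk.
  rewrite /st; case: b.
    under eq_fun do rewrite eqb_id.
    apply: measurable_fun_ifT => //; first exact: measurable_fun_ler.
    exact: measurableT_comp.
  under eq_fun do rewrite eqbF_neg -ltNge.
  apply: measurable_fun_ifT => //; first exact: measurable_fun_ltr.
  exact: measurableT_comp.
have stB b w : 0 <= st b w <= expR (k%:R * B).
  rewrite /st; case: ifP => _; first by rewrite expR_ge0 ler_expR stopped_sum_le.
  by rewrite lexx expR_ge0.
have ist b : P.-integrable setT (EFin \o st b).
  apply: (@integrable_bounded _ _ _ P _ (expR (k%:R * B))).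
    exact: (measurable_wrt_fun sFk).
  by move=> w; have /andP[s0 sB] := stB b w; rewrite ger0_norm.
have istD : P.-integrable setT (EFin \o (fun w => st false w * expR (D k.+1 w))).
  have mDk : measurable_fun setT (D k.+1).
    by apply: (measurable_wrt_fun (sF _ kn)); exact: mD.
  under eq_fun do rewrite mulrC.
  apply: (@integrable_mul_bounded _ _ _ P _ _ (expR B)) => //.
    exact: measurableT_comp.
  by move=> w; rewrite ger0_norm ?expR_ge0// ler_expR DB.
have -> : \int[P]_w expR (stopped_sum k w) = \int[P]_w st true w + \int[P]_w st false w.
  rewrite -RintegralD//; apply: eq_Rintegral => w _.
  by rewrite /st; case: (a <= _); rewrite ?addr0 ?add0r.
under eq_Rintegral => w _.
  rewrite (_ : expR _ = st true w + st false w * expR (D k.+1 w)); last first.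
    by rewrite /st; case: (a <= _); rewrite /= ?mul0r ?addr0 ?add0r ?expRD.
  over.
by rewrite RintegralD// lerD2l; apply: superD.
Qed.

(** Markov's inequality for the exponential of the stopped sum. *)
Lemma prob_stopped_sum_ge :
  (P [set w | (a <= stopped_sum n w)%R] <= (expR (- a))%:E)%E.
Proof.
have [sF _ _] := filF.
have mL := measurable_wrt_fun (sF _ (leqnn n)) (measurable_stopped_sum (leqnn n)).
set A := [set w | _].
have mA : measurable A.
  have /(_ measurableT [set true]) := measurable_fun_ler (measurable_cst a) mL.
  by rewrite setTI; apply.
have iL : P.-integrable setT (EFin \o (fun w => expR (stopped_sum n w))).
  apply: (@integrable_bounded _ _ _ P _ (expR (n%:R * B))).
    exact: measurableT_comp.
  by move=> w; rewrite ger0_norm ?expR_ge0// ler_expR stopped_sum_le.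
have -> : P A = (\int[P]_w \1_A w)%:E.
  by rewrite /Rintegral integral_indic// setIT fineK// fin_num_measure.
rewrite lee_fin; apply: (@le_trans _ _ (\int[P]_w (expR (- a) * expR (stopped_sum n w)))).
  apply: le_Rintegral => //; first exact: integrable_indic.
    exact: (integrableZl measurableT _ iL).
  move=> w _; rewrite indicE -expRD; have [|_] := boolP (w \in A); last exact: expR_ge0.
  by rewrite inE /A/= => aL; rewrite -(expR0 R) ler_expR; lra.
by rewrite RintegralZl// ler_piMr ?expR_ge0// Rintegral_exp_stopped_sum.
Qed.

End StoppedSum.

(** * Probabilities of the exceptional events *)

Section EventBounds.
Set Implicit Arguments.
Unset Strict Implicit.
Context {d : measure_display} {T : measurableType d} {R : realType}.
Variable P : probability T R.

(** The set [N] where [g < 0] lies in [G], so the integral of [g] over it equals that of [f] and is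
    nonnegative. Hence [|g|] integrates to 0 over [N], which forces [N] to be null. *)
Lemma cond_exp_ge0_ae (G : set (set T)) (f g : T -> R) : sub_sigma G ->
  is_cond_exp P G f g -> (forall w, 0 <= f w) -> P [set w | g w < 0] = 0%E.
Proof.
move=> sG [mg ig fg] f0; set N := [set w | _].
have GN : G N.
  have -> : N = g @^-1` `]-oo, 0[ by apply/seteqP; split=> w /=; rewrite in_itv.
  exact: mg.
have mN : measurable N := proj2 sG _ GN.
have iN : P.-integrable N (EFin \o g) by exact: integrableS ig.
have intN : (\int[P]_(w in N) `|(EFin \o g) w| = 0)%E.
  apply/eqP; rewrite eq_le integral_ge0 ?andbT; last by move=> w _; exact: abse_ge0.
  rewrite (eq_integral (fun w => (- (EFin \o g) w)%E)); last first.
    by move=> w; rewrite inE /N/= => gw; rewrite ltr0_norm// EFinN.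
  rewrite integralN/=; last first.
    by apply: fin_num_adde_defr; exact: (integrable_pos_fin_num mN iN).
  by rewrite oppe_le0 fg// integral_ge0// => w _; rewrite lee_fin.
have := (ae_eq_integral_abs P mN (measurable_int _ iN)).1 intN.
move=> ae0; apply/(negligibleP P mN); apply: negligibleS ae0.
by move=> w Nw /= /(_ Nw) [gw0]; move: Nw; rewrite /N/= gw0 ltxx.
Qed.

Lemma measurable_sum_nat (h : nat -> T -> R) (m n : nat) :
  (forall i, (m <= i < n)%N -> measurable_fun setT (h i)) ->
  measurable_fun setT (fun w => \sum_(m <= i < n) h i w).
Proof.
move=> mh.
(* Outside the index range, where [h] is arbitrary, the zero function is substituted. *)
rewrite (_ : (fun _ => _) =
    (fun w => \sum_(m <= i < n) (if (m <= i < n)%N then h i else cst 0) w)).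
  by apply: measurable_sum => i; case: ifP => // /mh.
by apply/funext => w; apply: eq_big_nat => i ->.
Qed.

(** Markov's inequality for the power [q], with the indicator kept inside the integral so that only
    large values contribute to the moment. *)
Lemma prob_gt_le_moment (X : T -> R) (y q : R) : measurable_fun setT X ->
  0 < y -> 0 <= q ->
  (P [set w | y < X w]%R <= ((y `^ q)^-1)%:E *
     \int[P]_w (`|X w| `^ q * (if y < X w then 1 else 0))%:E)%E.
Proof.
move=> mX y0 q0; set A := [set w | _].
have mA : measurable A.
  have /(_ measurableT [set true]) := measurable_fun_ltr (measurable_cst y) mX.
  by rewrite setTI; apply.
rewrite lee_pdivlMl ?powR_gt0//.
have -> : P A = (\int[P]_w (\1_A w)%:E)%E by rewrite integral_indic// setIT.
rewrite -ge0_integralZl_EFin//; last 2 first.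
- by apply/measurable_EFinP; exact: measurable_indic.
- exact: powR_ge0.
apply: ge0_le_integral => //.
- by move=> w _; rewrite mule_ge0// lee_fin powR_ge0.
- by apply/measurable_EFinP; apply: measurable_funM => //; exact: measurable_indic.
- apply/measurable_EFinP; apply: measurable_funM.
    apply: (measurableT_comp (measurable_powR q)); exact: measurableT_comp.
  by apply: measurable_fun_ifT => //; exact: measurable_fun_ltr.
move=> w _; rewrite -EFinM lee_fin indicE.
case: ifPn => [yX|/negP yX]; last by rewrite memNset// !mulr0.
rewrite mem_set// !mulr1 ge0_ler_powR ?nnegrE ?normr_ge0//; first exact: ltW.
by rewrite (le_trans (ltW yX))// ler_norm.
Qed.

End EventBounds.

(** * The tail bound, assembled from the stopped sum and the exceptional events *)

Theorem theorem2p3 (d : measure_display) (T : measurableType d) (R : realType)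
  (P : probability T R) (n : nat) (F : nat -> set (set T))
  (xi : nat -> T -> R) (V : nat -> T -> R) (p delta x v : R) :
  (1 <= n)%N ->
  is_mds P n F xi ->
  (* V i is (a version of) E[xi_i^2 | F_{i-1}], so <S>_k = sum_{i=1}^k V i *)
  (forall i, (1 <= i <= n)%N -> is_cond_exp P (F i.-1) (fun w => xi i w ^+ 2) (V i)) ->
  2 <= p -> 0 < delta ->
  (forall i, (1 <= i <= n)%N ->
     (\int[P]_w (powR `|xi i w| (p + delta))%:E < +oo)%E) ->
  0 < x -> 0 < v ->
  (P [set w | exists k, (1 <= k <= n)%N /\
                 (x <= \sum_(1 <= i < k.+1) xi i w)%R /\
                 (\sum_(1 <= i < k.+1) V i w <= v ^+ 2)%R]
   <= (expR (- (x ^+ 2) / (2 * (v ^+ 2 + 3^-1 * powR x ((2 * p + delta) / (p + delta))))))%:E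
      + ((powR x p)^-1)%:E *
        (\sum_(1 <= i < n.+1)
          \int[P]_w (powR `|xi i w| (p + delta) *
                     (if (powR x (p / (p + delta)) < xi i w)%R then 1 else 0))%:E))%E.
Proof.
move=> _ [filF _ mds] XV p2 delta0 _ x0 v0.
have [sF _ monF] := filF.
have sFi i : (1 <= i <= n)%N -> sub_sigma (F i) by case/andP=> _; exact: sF.
have sFi1 i : (1 <= i <= n)%N -> sub_sigma (F i.-1).
  by case/andP=> _ ?; apply: sF; rewrite (leq_trans (leq_pred _)).
have q0 : 0 < p + delta by lra.
set y := x `^ (p / (p + delta)).
have y0 : 0 < y by exact: powR_gt0.
have yq : y `^ (p + delta) = x `^ p by rewrite /y -powRrM divfK ?gt_eqF.
have xy : x `^ ((2 * p + delta) / (p + delta)) = x * y.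
  rewrite -{2}(powRr1 (ltW x0)) /y -powRD; last by rewrite (gt_eqF x0) implybT.
  by congr powR; field; rewrite gt_eqF.
rewrite xy; set D := v ^+ 2 + 3^-1 * (x * y).
have D0 : 0 < D by rewrite addr_gt0 ?exprn_gt0 ?mulr_gt0 ?invr_gt0.
pose l := x / D.
have l0 : 0 <= l by rewrite divr_ge0 ?ltW.
have v20 : 0 < v ^+ 2 by rewrite exprn_gt0.
have ly_E : 1 - l * y / 3 = v ^+ 2 / D.
  have -> : v ^+ 2 = D - x * y / 3 by rewrite /D; lra.
  by rewrite /l; field; rewrite gt_eqF.
have ly3 : l * y < 3 by have : 0 < v ^+ 2 / D by [exact: divr_gt0]; rewrite -ly_E; lra.
pose c := (2 * (1 - l * y / 3))^-1 * l ^+ 2.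
have c0 : 0 <= c.
  apply: mulr_ge0; last exact: sqr_ge0.
  by rewrite invr_ge0 ly_E mulr_ge0// divr_ge0// ltW.
(* Here [l * x = x ^+ 2 / D], and [c * v ^+ 2] is half of that since [ly_E] turns [c] into
   [x ^+ 2 / (2 * v ^+ 2 * D)]. *)
have exponent : l * x - c * v ^+ 2 = x ^+ 2 / (2 * D).
  by rewrite /c ly_E /l; field; rewrite !gt_eqF.
set a := l * x - c * v ^+ 2 in exponent.
pose Y i w := l * (if xi i w <= y then xi i w else 0) - c * Num.max (V i w) 0.
have mxi i : (1 <= i <= n)%N -> measurable_fun setT (xi i).
  by move=> ni; have [mi _ _] := mds i ni; exact: measurable_wrt_fun (sFi _ ni) _ mi.
have mV i : (1 <= i <= n)%N -> measurable_fun setT (V i).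
  by move=> ni; have [mi _ _] := XV i ni; exact: measurable_wrt_fun (sFi1 _ ni) _ mi.
have mY i : (1 <= i <= n)%N -> measurable_wrt (F i) (Y i).
  move=> ni; have sG := sFi _ ni; have [mi _ _] := mds i ni; have [mVi _ _] := XV i ni.
  have {}mVi : measurable_wrt (F i) (V i).
    move=> A mA; have := monF i.-1; case: i ni {sG mi} mVi => [//|i] /= ni mVi.
    by move=> /(_ ni); apply; exact: mVi.
  move/(measurable_wrtP sG) in mi; move/(measurable_wrtP sG) in mVi.
  apply/(measurable_wrtP sG); apply: measurable_funB; apply: measurable_funM => //.
    by apply: measurable_fun_ifT => //; exact: measurable_fun_ler.
  exact: measurable_maxr.
have YB i w : Y i w <= l * y.
  rewrite /Y lerBlDr; apply: (@le_trans _ _ (l * y)).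
    by rewrite ler_wpM2l//; case: ifPn => // _; exact: ltW.
  by rewrite lerDl mulr_ge0// le_max lexx orbT.
have superY i C W : (i < n)%N -> measurable_wrt (F i) W -> (forall w, 0 <= W w <= C) ->
    \int[P]_w (W w * expR (Y i.+1 w)) <= \int[P]_w W w.
  move=> ni mW WC; have [_ iX X0] := mds i.+1 ni.
  exact: (Rintegral_exp_increment (sF i (ltnW ni)) (mxi i.+1 ni) iX X0
    (XV i.+1 ni) mW WC l0 y0 ly3).
have hit := prob_stopped_sum_ge a filF mY (mulr_ge0 l0 (ltW y0))
  (fun i w _ => YB i w) superY.
(* The exceptional events: a jump above [y], or a negative value of the chosen version of the
   conditional variance. The index is shifted so that [i] runs below [n]. *)
pose A i := [set w | y < xi i.+1 w] `|` [set w | V i.+1 w < 0].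
set E := [set w | _].
set H := [set w | a <= stopped_sum Y a n w] in hit.
have EHA : E `<=` H `|` \big[setU/set0]_(i < n) A i.
  move=> w [k [/andP[k1 kn] [Sx Qv]]]; rewrite -bigcup_mkord.
  have [[i ni Aiw]|noA] := pselect (exists2 i, (i < n)%N & A i w).
    by right; exists i.
  (* Off these events neither the truncation nor the positive part acts, so the sum of the [Y i] up
     to [k] is at least [l * x - c * v ^+ 2 = a]. *)
  left; apply: stopped_sum_ge; exists k => //.
  have -> : \sum_(1 <= i < k.+1) Y i w =
      l * \sum_(1 <= i < k.+1) xi i w - c * \sum_(1 <= i < k.+1) V i w.
    rewrite !mulr_sumr -sumrB; apply: eq_big_nat => -[//|i] /= ik.
    have /not_orP[/negP xy_i /negP V0] : ~ A i w.
      by move=> Ai; apply: noA; exists i => //; exact: leq_trans kn.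
    by rewrite /Y leNgt xy_i max_l// leNgt.
  by rewrite /a lerD// ?lerN2 ler_wpM2l.
have mlt (f : T -> R) r : measurable_fun setT f -> measurable [set w | f w < r].
  move=> mf; have /(_ measurableT [set true]) := measurable_fun_ltr mf (measurable_cst r).
  by rewrite setTI; apply.
have mle (f : T -> R) r : measurable_fun setT f -> measurable [set w | f w <= r].
  move=> mf; have /(_ measurableT [set true]) := measurable_fun_ler mf (measurable_cst r).
  by rewrite setTI; apply.
have mgt (f : T -> R) r : measurable_fun setT f -> measurable [set w | r < f w].
  move=> mf; have /(_ measurableT [set true]) := measurable_fun_ltr (measurable_cst r) mf.
  by rewrite setTI; apply.
have mge (f : T -> R) r : measurable_fun setT f -> measurable [set w | r <= f w].
  move=> mf; have /(_ measurableT [set true]) := measurable_fun_ler (measurable_cst r) mf.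
  by rewrite setTI; apply.
have mA i : (i < n)%N -> measurable (A i).
  by move=> ni; apply: measurableU; [apply/mgt/(mxi i.+1)|apply/mlt/(mV i.+1)].
have mbigA : measurable (\big[setU/set0]_(i < n) A i).
  by apply: bigsetU_measurable => i _; exact: mA.
have mE : measurable E.
  rewrite (_ : E = \bigcup_(k in [set k | (1 <= k <= n)%N])
      ([set w | x <= \sum_(1 <= i < k.+1) xi i w] `&`
       [set w | \sum_(1 <= i < k.+1) V i w <= v ^+ 2])); last first.
    by apply/seteqP; split=> [w [k [kn Sk]]|w [k kn Sk]]; exists k.
  apply: bigcup_measurable => k /= /andP[_ kn].
  have le_k i : (1 <= i < k.+1)%N -> (1 <= i <= n)%N.
    by case/andP=> -> ik; exact: leq_trans kn.
  apply: measurableI.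
    by apply/mge/measurable_sum_nat => i /le_k; exact: mxi.
  by apply/mle/measurable_sum_nat => i /le_k; exact: mV.
have mH : measurable H.
  apply: mge; apply: (measurable_wrt_fun (sF _ (leqnn n))).
  exact: (measurable_stopped_sum _ filF mY).
have PA i : (i < n)%N -> (P (A i) <= ((x `^ p)^-1)%:E *
    \int[P]_w (`|xi i.+1 w| `^ (p + delta) * (if y < xi i.+1 w then 1 else 0))%:E)%E.
  move=> ni; rewrite -yq; apply: le_trans (prob_gt_le_moment P (mxi i.+1 ni) y0 (ltW q0)).
  apply: le_trans (measureU2 _ _ _) _; [exact/mgt/(mxi i.+1)|exact/mlt/(mV i.+1)|].
  (* Negative values of [V] form a null set, so only the jump counts. *)
  rewrite [X in (_ + X)%E](_ : _ = 0%E) ?adde0//.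
  by apply: (cond_exp_ge0_ae (sFi1 i.+1 ni) (XV i.+1 ni)) => w; exact: sqr_ge0.
apply: le_trans (le_measure P _ _ EHA) _; rewrite ?inE//; first exact: measurableU.
apply: le_trans (measureU2 _ _ _) _ => //.
apply: leeD.
  by apply: le_trans hit _; rewrite exponent mulNr.
rewrite big_add1 big_mkord ge0_sume_distrr//; last first.
  by move=> i _; apply: integral_ge0 => w _; rewrite lee_fin mulr_ge0 ?powR_ge0//; case: ifP.
apply: le_trans (Boole_inequality _ _) _ => //.
by apply: lee_sum => i _; exact: PA.
Qed.
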